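(* Let $v_0>0$ and $\hat\rho>0$, and let $$\mathcal F=\Bigl\{(\rho,m)\ :\ m\le \rho\,v_0\bigl(1-\rho/\hat\rho\bigr)\Bigr\}\subset\mathbb R\times\mathbb R .$$ Then, for a density–momentum pair $(\rho,m)$ with $\rho\ge 0$ and $m\in\mathbb R$, the proximal operator of the indicator function $\iota_{\mathcal F}$ (that is, the projection onto $\mathcal F$ in the Euclidean norm) is given by $$\operatorname{Proj}_{\mathcal F}(\rho,m)=\begin{cases}(\rho,m) & \text{if } m\le \rho\,v_0\bigl(1-\rho/\hat\rho\bigr),\\[4pt] \bigl(\rho^*,\ \rho^*v_0(1-\rho^*/\hat\rho)\bigr) & \text{otherwise,}\end{cases}$$ where $\rho^*$ is the positive root of the cubic polynomial equation in $\tilde\rho$ $$\frac{2v_0^2}{\hat\rho^2}\tilde\rho^3-\frac{3v_0^2}{\hat\rho}\tilde\rho^2+\Bigl(v_0^2+\frac{2m}{\hat\rho}v_0+1\Bigr)\tilde\rho-(\rho+mv_0)=0,$$ and hence admits a closed-form solution.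
   Context: The constraint is the pointwise Greenshields fundamental diagram constraint of traffic flow: $\rho$ is density, $m$ the (scalar) flux at a given space-time point, $v_0$ the free-flow speed and $\hat\rho$ the jam density. The indicator function $\iota_{\mathcal F}$ equals $0$ on $\mathcal F$ and $+\infty$ elsewhere. Its proximal operator is $$\operatorname{Proj}_{\mathcal F}(\rho,m)=\arg\min_{(\tilde\rho,\tilde m)\in\mathcal F}\tfrac12|\rho-\tilde\rho|^2+\tfrac12|m-\tilde m|^2 .$$ ''Closed-form'' refers to the solution of a cubic equation by Cardano's formula.
   Formalization: The cubic can have several positive roots (e.g. v₀=1, ρ̂=1, ρ=3, m=-4), so ''the positive root'' is ill-defined; here ρ* is the unique positive root with ρ*v₀(1-ρ*/ρ̂) < m, which is the positive root whenever there is only one. *)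

(* Defs.v *)
From mathcomp Require Import all_boot all_order all_algebra.
From mathcomp Require Import complex.
From mathcomp Require Import boolp classical_sets reals constructive_ereal.

Set Implicit Arguments.
Unset Strict Implicit.
Unset Printing Implicit Defensive.

Import Order.TTheory GRing.Theory Num.Theory.

Local Open Scope ring_scope.
Local Open Scope classical_set_scope.

(* The set of all minimisers: [argmin A f = [set x]] says that the minimum of
   [f] over [A] is attained, and only at [x]. *)
Definition argmin (T : Type) (d : Order.disp_t) (U : porderType d)
    (A : set T) (f : T -> U) : set T :=
  [set x | A x /\ forall y, A y -> (f x <= f y)%O].

(* Spelled out because the library's norm on [R * R] is the sup norm. *)
Definition half_sqdist (R : realType) (z w : R * R) : R :=
  2^-1 * `|z.1 - w.1| ^+ 2 + 2^-1 * `|z.2 - w.2| ^+ 2.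

Definition set_indicator {R : realType} (T : Type) (A : set T) (x : T) : \bar R :=
  if x \in A then 0%E else +oo%E.

Definition prox (R : realType) (g : R * R -> \bar R) (z : R * R) :
    set (R * R) :=
  argmin setT (fun w => (g w + (half_sqdist z w)%:E)%E).

Definition Proj (R : realType) (A : set (R * R)) (z : R * R) : set (R * R) :=
  argmin A (half_sqdist z).

Definition greenshields (R : realType) (v0 rhohat rho : R) : R :=
  rho * v0 * (1 - rho / rhohat).

Definition greenshields_set (R : realType) (v0 rhohat : R) : set (R * R) :=
  [set z | z.2 <= greenshields v0 rhohat z.1].

(* The stationarity equation of the squared distance from (rho, m) to the graph
   of [greenshields]. It may have several positive roots, e.g. for v0 = 1,
   rhohat = 1, rho = 3, m = -4; those at which the graph is not below m are
   not projections. *)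
Definition proj_cubic (R : realType) (v0 rhohat rho m : R) : {poly R} :=
  (2 * v0 ^+ 2 / rhohat ^+ 2) *: 'X^3
  - (3 * v0 ^+ 2 / rhohat) *: 'X^2
  + (v0 ^+ 2 + 2 * m / rhohat * v0 + 1) *: 'X
  - (rho + m * v0)%:P.

(* Cardano's formula for a X^3 + b X^2 + c X + d: with X = t - b / (3 a) the
   equation becomes t^3 + p t + q = 0, solved by t = u - p / (3 u), where u is
   a cube root of - q / 2 + s and s a square root of (q / 2)^2 + (p / 3)^3.
   The index [k] runs through the three cube roots. The sign of s is switched
   if - q / 2 + s = 0; then u = 0 only if p = q = 0, where the junk value
   0^-1 = 0 gives the correct t = 0. The radicals are complex, as they have to
   be when the cubic has three distinct real roots. *)
Definition cardano (C : numClosedFieldType) (a b c d : C) (k : nat) : C :=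
  let p := (3 * a * c - b ^+ 2) / (3 * a ^+ 2) in
  let q := (2 * b ^+ 3 - 9 * a * b * c + 27 * a ^+ 2 * d) / (27 * a ^+ 3) in
  let s := sqrtC ((q / 2) ^+ 2 + (p / 3) ^+ 3) in
  let w := if - (q / 2) + s == 0 then - (q / 2) - s else - (q / 2) + s in
  let zeta := (- 1 + 'i * sqrtC 3) / 2 in
  let u := zeta ^+ k * 3.-root w in
  u - p / (3 * u) - b / (3 * a).

Definition cardano_poly (R : realType) (P : {poly R}) (k : nat) : R[i] :=
  cardano (real_complex R P`_3) (real_complex R P`_2)
          (real_complex R P`_1) (real_complex R P`_0) k.

(* Main.v *)
(* The hypograph of a concave quadratic is convex, so stationarity with a positive
   multiplier [m - g x] is sufficient for projection, and it forces [0 < x] when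
   [0 <= rho]. Two such roots of the cubic both give the unique projection and
   hence coincide. *)
Require Import Defs.
From mathcomp Require Import all_boot all_order all_algebra.
From mathcomp Require Import complex.
From mathcomp Require Import boolp classical_sets reals constructive_ereal.
From mathcomp Require Import ring lra.

Import Order.TTheory GRing.Theory Num.Theory.

Local Open Scope ring_scope.
Local Open Scope classical_set_scope.

(** * Projections and proximal operators in the plane *)

Lemma prox_set_indicator (R : realType) (A : set (R * R)) (z : R * R) :
  A !=set0 -> prox (set_indicator A) z = Proj A z.
Proof.
move=> [w0 Aw0].
have indE w : A w -> set_indicator A w = 0%E :> \bar R.
  by move=> Aw; rewrite /set_indicator mem_set.
have indNE w : ~ A w -> set_indicator A w = +oo%E :> \bar R.
  by move=> NAw; rewrite /set_indicator memNset.
apply/seteqP; split => w [].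
- move=> _ minw.
  have Aw : A w.
    (* Outside [A] the objective is +oo, but at [w0] it is finite. For empty [A] every point would
       minimise the objective, whereas [Proj] would be empty. *)
    apply: contrapT => /indNE ew; have := minw w0 I.
    by rewrite ew indE// add0e addye// leye_eq.
  split=> // y Ay; have := minw y I.
  by rewrite !indE// !add0e lee_fin.
- move=> Aw minw; split=> // y _; rewrite (indE w)// add0e.
  have [Ay|/indNE ->] := pselect (A y); last by rewrite addye// leey.
  by rewrite indE// add0e lee_fin minw.
Qed.

Lemma half_sqdistE (R : realType) (z w : R * R) :
  half_sqdist z w = 2^-1 * (z.1 - w.1) ^+ 2 + 2^-1 * (z.2 - w.2) ^+ 2.
Proof. by rewrite /half_sqdist !real_normK ?num_real. Qed.

Lemma half_sqdist_ge0 (R : realType) (z w : R * R) : 0 <= half_sqdist z w.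
Proof. by rewrite half_sqdistE addr_ge0// mulr_ge0// ?sqr_ge0// invr_ge0. Qed.

Lemma half_sqdist_eq0 (R : realType) (z w : R * R) :
  half_sqdist z w <= 0 -> z = w.
Proof.
case: z w => [z1 z2] [w1 w2]; rewrite half_sqdistE /= -mulrDr.
rewrite pmulr_rle0 ?invr_gt0// => le0.
have : (z1 - w1) ^+ 2 + (z2 - w2) ^+ 2 == 0.
  by rewrite eq_le le0 addr_ge0// sqr_ge0.
rewrite paddr_eq0 ?sqr_ge0// !sqrf_eq0 !subr_eq0.
by move=> /andP[/eqP -> /eqP ->].
Qed.

(* By the three-point identity, the hypothesis is the obtuse-angle criterion
   for [p] to be the projection of [z]. *)
Lemma Proj_obtuse (R : realType) (A : set (R * R)) (z p : R * R) :
  A p ->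
  (forall w, A w ->
    (z.1 - p.1) * (w.1 - p.1) + (z.2 - p.2) * (w.2 - p.2) <= 0) ->
  Proj A z = [set p].
Proof.
move=> Ap obt.
have key w : A w -> half_sqdist z p + half_sqdist p w <= half_sqdist z w.
  by move=> /obt; rewrite !half_sqdistE; lra.
apply/seteqP; split => w /=.
- move=> [Aw minw]; apply/esym/half_sqdist_eq0.
  have := le_trans (key w Aw) (minw p Ap); lra.
- move=> ->; split=> // y Ay; apply: le_trans (key y Ay).
  by rewrite lerDl half_sqdist_ge0.
Qed.

(** * Projection onto the Greenshields hypograph *)

Section Greenshields.
Variables (R : realType) (v0 rhohat : R).
Hypotheses (hv0 : 0 < v0) (hrhohat : 0 < rhohat).

Local Notation g := (greenshields v0 rhohat).
Local Notation dg x := (v0 * (1 - 2 * x / rhohat)).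

Lemma greenshields_tangent (x y : R) : g y <= g x + dg x * (y - x).
Proof.
rewrite -subr_ge0.
have -> : g x + dg x * (y - x) - g y = v0 / rhohat * (y - x) ^+ 2.
  by rewrite /greenshields; field; rewrite gt_eqF.
by rewrite mulr_ge0 ?sqr_ge0// divr_ge0// ltW.
Qed.

(** The cubic is the derivative at [x] of half the squared distance from [(rho, m)] to [(x, g x)],
    namely [(x - rho) - (m - g x) * dg x]. *)
Lemma root_proj_cubic (rho m x : R) :
  root (proj_cubic v0 rhohat rho m) x = (x - rho == (m - g x) * dg x).
Proof.
rewrite rootE -[RHS]subr_eq0; congr (_ == _).
rewrite /proj_cubic /greenshields.
rewrite !(hornerD, hornerN, hornerZ, hornerXn, hornerX, hornerC).
by field; rewrite gt_eqF.
Qed.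

(** By stationarity, [(rho, m) - (x, g x)] is the positive number [m - g x] times the upward normal
    [(- dg x, 1)], so the obtuse-angle criterion amounts to the hypograph lying below the tangent at
    [x]. *)
Lemma Proj_greenshields_root (rho m x : R) :
  root (proj_cubic v0 rhohat rho m) x -> g x < m ->
  Proj (greenshields_set v0 rhohat) (rho, m) = [set (x, g x)].
Proof.
rewrite root_proj_cubic => /eqP statx gxm.
apply: Proj_obtuse => [|[y n] /=]; first exact: lexx.
rewrite /greenshields_set /= => ngy.
have -> : (rho - x) * (y - x) + (m - g x) * (n - g x)
    = (m - g x) * (n - (g x + dg x * (y - x))).
  by rewrite -[rho - x]opprB statx; ring.
rewrite pmulr_rle0 ?subr_gt0// subr_le0.
exact: le_trans ngy (greenshields_tangent x y).
Qed.

(** With the multiplier [l = m - g x] held fixed, stationarity is a linear equation in [x] with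
    positive coefficient and positive right-hand side. *)
Lemma root_proj_cubic_gt0 (rho m x : R) : 0 <= rho ->
  root (proj_cubic v0 rhohat rho m) x -> g x < m -> 0 < x.
Proof.
move=> rho0; rewrite root_proj_cubic => /eqP statx gxm.
have l0 : 0 < m - g x by rewrite subr_gt0.
set l := m - g x in statx l0.
have D0 : 0 < 1 + l * v0 * 2 / rhohat.
  by rewrite ltr_wpDr// !mulr_ge0// ?invr_ge0 ltW.
rewrite -(pmulr_rgt0 _ D0).
have -> : (1 + l * v0 * 2 / rhohat) * x = rho + l * v0.
  have -> : (1 + l * v0 * 2 / rhohat) * x
      = (x - rho) + rho + l * v0 * 2 / rhohat * x by ring.
  by rewrite statx; ring.
by rewrite ltr_wpDl// mulr_gt0.
Qed.

(* Stationarity with multiplier [l = m - g x] means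
   [x = (rho + l v0) / (1 + 2 l v0 / rhohat)]; the equation [l = m - g x],
   cleared of denominators, is solved by the intermediate value theorem on
   [0, m - g rho]: that [x] lies between [rho] and [rhohat / 2], so
   [g rho <= g x]. *)
Lemma exists_root_proj_cubic (rho m : R) : g rho < m ->
  exists2 x, root (proj_cubic v0 rhohat rho m) x & g x < m.
Proof.
move=> grm.
pose D : {poly R} := (2 * v0 / rhohat) *: 'X + 1.
pose N : {poly R} := v0 *: 'X + rho%:P.
pose F : {poly R} := D ^+ 2 * ('X - m%:P) + v0 *: (N * (D - rhohat^-1 *: N)).
pose xi l := N.[l] / D.[l].
have DE l : D.[l] = 2 * v0 / rhohat * l + 1.
  by rewrite !(hornerD, hornerZ, hornerX, hornerC).
have NE l : N.[l] = v0 * l + rho.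
  by rewrite !(hornerD, hornerZ, hornerX, hornerC).
have D_gt0 l : 0 <= l -> 0 < D.[l].
  by move=> l0; rewrite DE ltr_wpDl// !mulr_ge0// ?invr_ge0 ltW.
have den_neq0 l : 0 <= l -> (rhohat != 0) && (2 * v0 * l + rhohat != 0).
  by move=> l0; rewrite !gt_eqF// ltr_wpDl// !mulr_ge0// ltW.
have FE l : 0 <= l -> F.[l] = D.[l] ^+ 2 * (l - m + g (xi l)).
  move=> l0; rewrite /F /xi /greenshields.
  rewrite !(hornerD, hornerM, horner_exp, hornerN, hornerZ, hornerX, hornerC).
  by field; exact: den_neq0.
have xi0 : xi 0 = rho by rewrite /xi NE DE !mulr0 !add0r divr1.
have grm0 : 0 < m - g rho by rewrite subr_gt0.
have F0 : F.[0] < 0.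
  by rewrite FE// xi0 pmulr_rlt0 ?exprn_gt0 ?D_gt0//; lra.
have FL : 0 <= F.[m - g rho].
  have L0 := ltW grm0; rewrite FE// mulr_ge0 ?sqr_ge0//.
  set L := m - g rho in L0 *.
  have -> : L - m + g (xi L) = g (xi L) - g rho by rewrite /L; ring.
  (* In [g x - g rho = v0 / rhohat * (x - rho) * (rhohat - rho - x)] at [x = xi L], both
     non-constant factors are nonnegative multiples of [rhohat - 2 * rho], whence the square. *)
  have -> : g (xi L) - g rho =
      L * (v0 / rhohat) ^+ 2 * (rhohat - 2 * rho) ^+ 2 * (1 + L * v0 / rhohat)
      / D.[L] ^+ 2.
    by rewrite /xi /greenshields NE DE; field; exact: den_neq0.
  have fac0 : 0 <= 1 + L * v0 / rhohat.
    by rewrite addr_ge0// divr_ge0 ?mulr_ge0// ltW.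
  rewrite divr_ge0 ?sqr_ge0// mulr_ge0// mulr_ge0 ?sqr_ge0//.
  by rewrite mulr_ge0 ?sqr_ge0.
have [l /andP[l0 _] rl] : exists2 l, 0 <= l <= m - g rho & root F l.
  by apply: poly_ivt; rewrite ?(ltW F0) ?FL ?(ltW grm0).
(* The strict sign of [F.[0]] excludes [l = 0]; this gives the strict inequality [g x < m]. *)
have l_gt0 : 0 < l.
  rewrite lt_neqAle l0 andbT; apply: contraTneq rl => <-.
  by rewrite rootE lt_eqF.
have DlN0 := lt0r_neq0 (D_gt0 _ l0).
have lE : m - g (xi l) = l.
  move: rl; rewrite rootE FE// mulf_eq0 sqrf_eq0 (negbTE DlN0) /= => /eqP; lra.
exists (xi l); last by rewrite -subr_gt0 lE.
rewrite root_proj_cubic lE /xi.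
apply/eqP; rewrite NE DE; field; exact: den_neq0.
Qed.

End Greenshields.

(** * Cardano's formula *)

(* With [u1 = -p / (3 u)], the cubic factors as the product over [k] of
   [T - zeta^k u - zeta^-k u1], because [u^3 + u1^3 = - q]. *)
Lemma cardano_root (C : numClosedFieldType) (a b c d t : C) :
  a != 0 -> a * t ^+ 3 + b * t ^+ 2 + c * t + d = 0 ->
  exists k : 'I_3, t = cardano a b c d k.
Proof.
move=> a0 rt; rewrite /cardano.
set p := (3 * a * c - b ^+ 2) / _.
set q := (2 * b ^+ 3 - _ + _) / _.
set s := sqrtC (_ ^+ 2 + _).
set w := if _ then _ else _.
set z : C := (- 1 + _) / 2.
set T := t + b / (3 * a).
have depressed : T ^+ 3 + p * T + q = 0.
  have -> : T ^+ 3 + p * T + q = (a * t ^+ 3 + b * t ^+ 2 + c * t + d) / a.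
    by rewrite /T /p /q; field.
  by rewrite rt mul0r.
have s2 : s ^+ 2 = (q / 2) ^+ 2 + (p / 3) ^+ 3 by exact: sqrtCK.
(* [z] is a primitive cube root of unity. *)
have z2 : z ^+ 2 = - z - 1.
  have -> : z ^+ 2 = (1 - 2 * ('i * sqrtC 3) + 'i ^+ 2 * (sqrtC 3) ^+ 2) / 4.
    by rewrite /z; field.
  by rewrite sqrCi sqrtCK /z; field.
have tE y : T = y -> t = y - b / (3 * a) by move=> <-; rewrite /T addrK.
(* Whichever sign of [s] was chosen, [w] is a root of the resolvent quadratic. *)
have w2 : w ^+ 2 + q * w = (p / 3) ^+ 3.
  have -> : (p / 3) ^+ 3 = s ^+ 2 - (q / 2) ^+ 2 by rewrite s2 addrC addKr.
  by rewrite /w; case: ifP => _; field.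
have u3 : (3.-root w) ^+ 3 = w by rewrite rootCK.
set u := 3.-root w in u3 *.
(* [w = 0] means that both [- (q / 2) + s] and [- (q / 2) - s] vanish, so their sum [- q] does too;
   the resolvent gives [p = 0], leaving [T ^+ 3 = 0]. *)
have [w0|w0] := eqVneq w 0.
  have u0 : u = 0 by move/eqP: u3; rewrite w0 expf_eq0 => /eqP.
  have p0 : p = 0.
    move/eqP: w2; rewrite w0 expr0n /= mulr0 addr0 eq_sym expf_eq0 /=.
    by rewrite mulf_eq0 invr_eq0 pnatr_eq0 orbF => /eqP.
  have q0 : q = 0.
    move: w0; rewrite /w; case: eqP => // e1 e2.
    rewrite (_ : q = - ((- (q / 2) + s) + (- (q / 2) - s))); last by field.
    by rewrite e1 e2 addr0 oppr0.
  exists ord0; apply: tE; rewrite u0 p0 mulr0 !mul0r subr0.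
  move/eqP: depressed; rewrite p0 q0 mul0r !addr0.
  by rewrite expf_eq0 => /eqP.
have u0 : u != 0 by apply: contraNneq w0 => u0; rewrite -u3 u0 expr0n.
have z0 : z != 0.
  apply/eqP => z0; move/eqP: z2.
  by rewrite z0 expr0n oppr0 sub0r eq_sym oppr_eq0 oner_eq0.
have z3 : z ^+ 3 = 1 by rewrite exprS z2 mulrBr mulrN -expr2 z2; ring.
have zV : z^-1 = z ^+ 2 by apply: (mulfI z0); rewrite mulfV// -exprS z3.
pose u1 := - p / (3 * u).
have uu1 : u * u1 = - p / 3 by rewrite /u1; field.
(* [u1 ^+ 3] is the other root of the resolvent: its product with [w] is
   [(u * u1) ^+ 3 = - (p / 3) ^+ 3]. *)
have u13 : u1 ^+ 3 = - q - w.
  apply: (mulfI w0); rewrite -{1}u3 -exprMn uu1.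
  have -> : (- p / 3) ^+ 3 = - (p / 3) ^+ 3 by rewrite mulNr exprNn; ring.
  by rewrite -w2; ring.
have fac : (T - (u + u1)) * (T - (z * u + z ^+ 2 * u1))
         * (T - (z ^+ 2 * u + z * u1)) = 0.
  rewrite -[RHS]depressed !z2.
  have -> : q = - (u ^+ 3 + u1 ^+ 3) by rewrite u13 u3; ring.
  have -> : p = - 3 * (u * u1) by rewrite uu1; field.
  ring: z2.
(* Replacing [u] by [z ^+ k * u] multiplies [u1] by the inverse of [z ^+ k], which is
   [z ^+ (2 * k)]. *)
have cE k : z ^+ k * u - p / (3 * (z ^+ k * u)) = z ^+ k * u + z ^+ (2 * k) * u1.
  rewrite /u1 exprM -zV exprVn; field; rewrite u0 expf_neq0//.
move/eqP: fac; rewrite !mulf_eq0 !subr_eq0 => /orP[/orP[]|] /eqP e.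
- by exists ord0; apply: tE; rewrite cE e !mul1r.
- by exists 1; apply: tE; rewrite cE e.
- exists 2; apply: tE; rewrite cE e /=.
  by rewrite (exprD z 3 1) z3 mul1r.
Qed.

Lemma cardano_poly_root (R : realType) (P : {poly R}) (x : R) :
  size P = 4 -> root P x -> exists k : 'I_3, real_complex R x = cardano_poly P k.
Proof.
move=> sP rx; apply: cardano_root.
  rewrite fmorph_eq0; have : lead_coef P != 0.
    by rewrite lead_coef_eq0 -size_poly_eq0 sP.
  by rewrite lead_coefE sP.
rewrite -!rmorphXn -!rmorphM -!rmorphD -[RHS](rmorph0 (real_complex R)).
congr (real_complex R _); rewrite -[RHS](rootP rx) horner_coef sP.
by rewrite !big_ord_recl big_ord0 /=; ring.
Qed.

(** Guarantees that the leading coefficient, by which Cardano's formula divides, is nonzero. *)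
Lemma size_proj_cubic (R : realType) (v0 rhohat rho m : R) :
  v0 != 0 -> rhohat != 0 -> size (proj_cubic v0 rhohat rho m) = 4.
Proof.
move=> v00 h0.
have lead0 : 2 * v0 ^+ 2 / rhohat ^+ 2 != 0.
  by rewrite !mulf_neq0 ?invr_eq0 ?sqrf_eq0 ?pnatr_eq0.
rewrite /proj_cubic -2!addrA size_polyDl size_scale ?size_polyXn//.
rewrite (leq_ltn_trans (size_polyD _ _))// gtn_max size_polyN.
rewrite (leq_ltn_trans (size_scale_leq _ _)) ?size_polyXn//=.
rewrite (leq_ltn_trans (size_polyD _ _))// gtn_max size_polyN.
rewrite (leq_ltn_trans (size_scale_leq _ _)) ?size_polyX//=.
by rewrite (leq_ltn_trans (size_polyC_leq1 _)).
Qed.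

Theorem proposition5 (R : realType) (v0 rhohat : R)
    (hv0 : 0 < v0) (hrhohat : 0 < rhohat) (rho m : R) (hrho : 0 <= rho) :
  [/\ prox (set_indicator (greenshields_set v0 rhohat)) (rho, m)
        = Proj (greenshields_set v0 rhohat) (rho, m),
      m <= greenshields v0 rhohat rho ->
        Proj (greenshields_set v0 rhohat) (rho, m) = [set (rho, m)]
    & ~~ (m <= greenshields v0 rhohat rho) ->
        exists rhos : R,
          [/\ [/\ 0 < rhos, root (proj_cubic v0 rhohat rho m) rhos
                & greenshields v0 rhohat rhos < m],
              forall x : R, 0 < x -> root (proj_cubic v0 rhohat rho m) x ->
                greenshields v0 rhohat x < m -> x = rhos,
              Proj (greenshields_set v0 rhohat) (rho, m)
                = [set (rhos, greenshields v0 rhohat rhos)]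
            & exists k : 'I_3,
                real_complex R rhos
                  = cardano_poly (proj_cubic v0 rhohat rho m) k]].
Proof.
split.
- apply: prox_set_indicator; exists (0, 0).
  by rewrite /greenshields_set /greenshields /= !mul0r.
- move=> mg; apply: Proj_obtuse => // w _.
  by rewrite !subrr !mul0r addr0.
rewrite -ltNge => /(exists_root_proj_cubic _ _ _ hv0 hrhohat)[x rx gx].
have PE := Proj_greenshields_root _ _ _ hv0 hrhohat _ _ _ rx gx.
exists x; split.
- by split=> //; exact: (root_proj_cubic_gt0 _ _ _ hv0 hrhohat _ _ _ hrho rx gx).
- move=> y _ ry gy.
  have : [set (y, greenshields v0 rhohat y)] (x, greenshields v0 rhohat x).
    by rewrite -(Proj_greenshields_root _ _ _ hv0 hrhohat _ _ _ ry gy)// PE.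
  by move=> /= [].
- exact: PE.
- by apply: cardano_poly_root rx; rewrite size_proj_cubic// gt_eqF.
Qed.
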